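(* Let $k$ be an algebraically closed field of characteristic zero and let $R$ be an affine $k$-algebra such that the symmetric algebra $S(\Omega^{(1)}(R/k))$ admits at least one symmetric derivation. Then $\Omega^{(1)}(R/k)$ is a projective $R$-module if and only if $\Omega^{(2)}(R/k)$ is a projective $R$-module.
   Context: An affine $k$-algebra is a finitely generated commutative $k$-algebra with unit. $I_R$ is the kernel of the multiplication map $R\otimes_kR\to R$; $\Omega^{(q)}(R/k)=I_R/I_R^{q+1}$ with canonical $q$-th order derivation $\delta^{(q)}(r)=1\otimes r-r\otimes1\bmod I_R^{q+1}$. $S(\Omega^{(1)}(R/k))=\bigoplus_{p\ge0}S^p(\Omega^{(1)}(R/k))$ is the symmetric algebra over $R$, with $S^0=R$. A symmetric derivation is a $k$-linear map $D:S(\Omega^{(1)}(R/k))\to S(\Omega^{(1)}(R/k))$ such that (i) $D(S^p(\Omega^{(1)}(R/k)))\subset S^{p+1}(\Omega^{(1)}(R/k))$ for all $p$, (ii) $D$ is a first order derivation over $k$, and (iii) the restriction of $D$ to $R=S^0(\Omega^{(1)}(R/k))$ is $\delta^{(1)}:R\to\Omega^{(1)}(R/k)$. *)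

(* Defs.v *)
From HB Require Import structures.
From mathcomp Require Import all_boot all_order all_algebra.
Set Implicit Arguments. Unset Strict Implicit. Unset Printing Implicit Defensive.
Import Order.TTheory GRing.Theory Num.Theory.
Local Open Scope ring_scope.

Definition additive_fun (U V : zmodType) (f : U -> V) : Prop :=
  forall x y, f (x + y) = f x + f y.

Definition scalable_fun (K : pzRingType) (U V : lmodType K) (f : U -> V) : Prop :=
  forall (a : K) x, f (a *: x) = a *: f x.

Definition alg_morph (K : pzRingType) (A B : lalgType K) (f : A -> B) : Prop :=
  [/\ additive_fun f, scalable_fun f,
      (forall x y, f (x * y) = f x * f y) & f 1 = 1].

Inductive in_subalg (k : fieldType) (R : comAlgType k) (G : R -> Prop) : R -> Prop :=
  | sa_gen x : G x -> in_subalg G x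
  | sa_one : in_subalg G 1
  | sa_add x y : in_subalg G x -> in_subalg G y -> in_subalg G (x + y)
  | sa_mul x y : in_subalg G x -> in_subalg G y -> in_subalg G (x * y)
  | sa_scale (a : k) x : in_subalg G x -> in_subalg G (a *: x).

Definition affine_algebra (k : fieldType) (R : comAlgType k) : Prop :=
  exists (n : nat) (g : 'I_n -> R),
    forall x : R, in_subalg (fun y => exists i, y = g i) x.

(* T together with i1 : r |-> r (x) 1 and i2 : r |-> 1 (x) r is a tensor
   product of R with itself over k (as k-algebras). *)
Definition is_tensor_square (k : fieldType) (R T : comAlgType k)
    (i1 i2 : R -> T) : Prop :=
  [/\ alg_morph i1, alg_morph i2 &
   forall (V : lmodType k) (b : R -> R -> V),
     (forall y, additive_fun (b^~ y) /\ scalable_fun (b^~ y)) ->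
     (forall x, additive_fun (b x) /\ scalable_fun (b x)) ->
     (exists f : T -> V, [/\ additive_fun f, scalable_fun f &
                             forall x y, f (i1 x * i2 y) = b x y]) /\
     (forall f g : T -> V, additive_fun f -> scalable_fun f ->
        additive_fun g -> scalable_fun g ->
        (forall x y, f (i1 x * i2 y) = g (i1 x * i2 y)) -> f =1 g)].

Section Omega.
Variables (k : fieldType) (R T : comAlgType k) (i1 i2 : R -> T).

(* I_R : kernel of the multiplication map R (x)_k R -> R, a (x) b |-> a b *)
Definition I_R (x : T) : Prop :=
  forall m : T -> R, additive_fun m -> scalable_fun m ->
    (forall a b, m (i1 a * i2 b) = a * b) -> m x = 0.

Definition ideal_pow (P : T -> Prop) (n : nat) (x : T) : Prop :=
  exists (m : nat) (c : 'I_m -> T) (a : 'I_m -> 'I_n -> T),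
    (forall i l, P (a i l)) /\ x = \sum_(i < m) c i * \prod_(l < n) a i l.

Definition Rlinear_on_I (M : lmodType R) (g : T -> M) : Prop :=
  forall (r : R) x y, I_R x -> I_R y -> g (i1 r * x + y) = r *: g x + g y.

(* R-linear maps Omega^(q)(R/k) = I_R / I_R^(q+1) -> M are exactly the
   g : T -> M that are R-linear on I_R and vanish on I_R^(q+1). *)
Definition Omega_hom (q : nat) (M : lmodType R) (g : T -> M) : Prop :=
  Rlinear_on_I g /\ (forall x, ideal_pow I_R q.+1 x -> g x = 0).

Definition Omega_projective (q : nat) : Prop :=
  forall (N L : lmodType R) (f : N -> L),
    additive_fun f -> scalable_fun f -> (forall y, exists x, f x = y) ->
    forall g : T -> L, Omega_hom q g ->
      exists h : T -> N, Omega_hom q h /\ (forall x, I_R x -> f (h x) = g x).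

(* (S, j) is the symmetric algebra S(Omega^(1)(R/k)) over R, with
   j : I_R -> I_R/I_R^2 = Omega^(1) = S^1 the canonical map. *)
Definition is_sym_alg_Omega1 (S : comAlgType R) (j : T -> S) : Prop :=
  Omega_hom 1 j /\
  forall (B : comAlgType R) (phi : T -> B), Omega_hom 1 phi ->
    (exists psi : S -> B, alg_morph psi /\ (forall x, I_R x -> psi (j x) = phi x)) /\
    (forall psi1 psi2 : S -> B, alg_morph psi1 -> alg_morph psi2 ->
       (forall x, I_R x -> psi1 (j x) = psi2 (j x)) -> psi1 =1 psi2).

Section Sym.
Variables (S : comAlgType R) (j : T -> S).

Definition Sdeg (p : nat) (s : S) : Prop :=
  exists (m : nat) (c : 'I_m -> R) (a : 'I_m -> 'I_p -> T),
    (forall i l, I_R (a i l)) /\ s = \sum_(i < m) c i *: \prod_(l < p) j (a i l).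

Definition first_order_derivation (D : S -> S) : Prop :=
  [/\ additive_fun D,
      (forall (a : k) s, D ((a%:A : R) *: s) = (a%:A : R) *: D s) &
      (forall s t, D (s * t) = s * D t + t * D s)].

Definition symmetric_derivation (D : S -> S) : Prop :=
  [/\ forall p s, Sdeg p s -> Sdeg p.+1 (D s),
      first_order_derivation D &
      (* D restricted to R = S^0 is delta^(1) : r |-> 1 (x) r - r (x) 1 mod I^2 *)
      forall r : R, D (r%:A) = j (i2 r - i1 r)].

End Sym.
End Omega.

(* Main.v *)
(* A symmetric derivation D splits Omega^(2) -> Omega^(1). The map
   a (x) b |-> a D^2 b induces sq : Omega^(2) -> S^2(Omega^(1)), and on I^2 the
   Leibniz rule gives sq (x y) = 2 (j x) (j y). Since a linear map h on Omega^(2)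
   yields psi : S^2 -> N with psi (j x * j y) = h (x y), the map h - psi sq / 2
   vanishes on I^2. Hence Omega^(1) is a summand of Omega^(2), the complement
   being S^2(Omega^(1)). If Omega^(1) is projective, it has a finite dual basis,
   and this lets one lift maps out of S^2 along surjections. *)
Require Import Defs.
From HB Require Import structures.
From mathcomp Require Import all_boot all_order all_algebra.
From mathcomp Require Import boolp ring.
Set Implicit Arguments. Unset Strict Implicit. Unset Printing Implicit Defensive.
Import GRing.Theory.
Local Open Scope ring_scope.

(** * Submodules cut out by a propositional predicate *)

Definition submod_axiom (K : pzRingType) (V : lmodType K) (P : V -> Prop) :=
  P 0 /\ forall a x y, P x -> P y -> P (a *: x + y).

Section Submodule.
Variables (K : pzRingType) (V : lmodType K) (P : V -> Prop).
Hypothesis subP : submod_axiom P.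

(** The closure proof is an argument, so that the instances keyed on [submod_pred subP] can recover
    it by unification. *)
Definition submod_pred of submod_axiom P : V -> bool := fun x => `[< P x >].

Fact submod_pred_closed : subsemimod_closed (submod_pred subP).
Proof.
have [P0 PZD] := subP.
split; first split.
- exact/asboolP.
- by move=> x y /asboolP px /asboolP py; apply/asboolP; rewrite -[x]scale1r; apply: PZD.
- by move=> a x /asboolP px; apply/asboolP; rewrite -[_ *: _]addr0; apply: PZD.
Qed.

HB.instance Definition _ :=
  GRing.isSubmodClosed.Build K V (submod_pred subP) submod_pred_closed.

Record submod_type (hP : submod_axiom P) :=
  Submod { submod_val :> V; submod_valP : submod_pred hP submod_val }.
Local Notation W := (submod_type subP).

HB.instance Definition _ := [isSub for @submod_val subP].
HB.instance Definition _ := [Choice of W by <:].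
HB.instance Definition _ := [SubChoice_isSubZmodule of W by <:].
HB.instance Definition _ := [SubZmodule_isSubLmodule of W by <:].

Lemma submodP (w : W) : P (val w).
Proof. exact/asboolP/(valP w). Qed.

Lemma submod_ex v : P v -> exists w : W, val w = v.
Proof. by move=> /asboolP pv; exists (Submod pv). Qed.

End Submodule.

(** * Restriction of scalars from an algebra to its base ring *)

Section RestrictScalars.
Variables (k : pzRingType) (R : lalgType k) (V : lmodType R).

(** The universal property of the tensor square asks for modules over [k], whereas the symmetric
    algebra is given as a module over [R]. The alias carries the [k]-structure without touching the
    one over [R]. *)
Definition restrict_scalars : Type := V.
Local Notation W := restrict_scalars.
HB.instance Definition _ := GRing.Zmodule.on W.

Definition restr_scale (a : k) (v : W) : W := (a%:A : R) *: (v : V).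
Fact restr_scaleA a b v : restr_scale a (restr_scale b v) = restr_scale (a * b) v.
Proof. by rewrite /restr_scale !scalerA -scalerAl mul1r scalerA. Qed.
Fact restr_scale1 : left_id 1 restr_scale.
Proof. by move=> v; rewrite /restr_scale !scale1r. Qed.
Fact restr_scaleDr : right_distributive restr_scale +%R.
Proof. by move=> a u v; rewrite /restr_scale scalerDr. Qed.
Fact restr_scaleDl v : {morph restr_scale^~ v : a b / a + b}.
Proof. by move=> a b; rewrite /restr_scale !scalerDl. Qed.
HB.instance Definition _ := GRing.Zmodule_isLmodule.Build k W
  restr_scaleA restr_scale1 restr_scaleDr restr_scaleDl.
End RestrictScalars.

(** * Commutative graded algebras truncated above degree 2 *)

Section GradedAlgebra.
Variables (R : comNzRingType) (M N : lmodType R) (b : M -> M -> N).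

Definition sym_bilinear :=
  (forall x y, b x y = b y x) /\
  (forall a x x' y, b (a *: x + x') y = a *: b x y + b x' y).
Hypothesis hb : sym_bilinear.

Fact sbC x y : b x y = b y x. Proof. exact: hb.1. Qed.
Fact sbDl x x' y : b (x + x') y = b x y + b x' y.
Proof. by rewrite -[x]scale1r hb.2 !scale1r. Qed.
Fact sbZl a x y : b (a *: x) y = a *: b x y.
Proof.
have b0 : b 0 y = 0 by apply: (addrI (b 0 y)); rewrite -sbDl !addr0.
by rewrite -[a *: x]addr0 hb.2 b0 addr0.
Qed.
Fact sbDr x y y' : b x (y + y') = b x y + b x y'.
Proof. by rewrite !(sbC x) sbDl. Qed.
Fact sbZr a x y : b x (a *: y) = a *: b x y.
Proof. by rewrite !(sbC x) sbZl. Qed.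

(* [R + M + N] graded in degrees 0, 1, 2: the product of two degree 1 elements
   is given by [b], and everything of degree at least 3 vanishes. *)
Definition graded_alg of sym_bilinear : Type := (R^o * M * N)%type.
Local Notation B := (graded_alg hb).
HB.instance Definition _ := GRing.Lmodule.on B.

Definition galg_one : B := (1, 0, 0).
Definition galg_mul (u v : B) : B :=
  (u.1.1 * v.1.1, (u.1.1 : R) *: v.1.2 + (v.1.1 : R) *: u.1.2,
   (u.1.1 : R) *: v.2 + b u.1.2 v.1.2 + (v.1.1 : R) *: u.2).

Fact galg_mulC : commutative galg_mul.
Proof.
move=> [[r x] n] [[s y] p]; rewrite /galg_mul /=; congr (_, _, _).
- exact: mulrC.
- exact: addrC.
- by rewrite (sbC x) [RHS]addrC addrA addrAC.
Qed.

(** A product of three elements of degree 1 vanishes, so in degree 2 only bilinearity of [b]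
    enters. *)
Fact galg_mulA : associative galg_mul.
Proof.
move=> [[r x] n] [[s y] p] [[t z] q]; rewrite /galg_mul /=; congr (_, _, _).
- exact: mulrA.
- rewrite !scalerDr !scalerA addrA; congr (_ + _ + _); by rewrite mulrC.
- rewrite !scalerDr !sbDl !sbDr !sbZl !sbZr !scalerA !addrA.
  rewrite (mulrC t r) (mulrC t s).
  by congr (_ + _ + _); rewrite addrAC.
Qed.

Fact galg_mul1 : left_id galg_one galg_mul.
Proof.
move=> [[r x] n]; rewrite /galg_mul /galg_one /=.
rewrite mul1r !scale1r !scaler0 !addr0 -[0](scale0r (0 : M)) sbZl scale0r.
by rewrite addr0.
Qed.

Fact galg_mulDl : left_distributive galg_mul +%R.
Proof.
move=> [[r x] n] [[s y] p] [[t z] q]; rewrite /galg_mul /=; congr (_, _, _).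
- exact: mulrDl.
- rewrite /= scalerDl scalerDr !addrA; congr (_ + _).
  by rewrite -!addrA; congr (_ + _); rewrite addrC.
- by rewrite /= scalerDl scalerDr sbDl [RHS]addrACA; congr (_ + _); rewrite addrACA.
Qed.

Fact galg_one_neq0 : galg_one != 0.
Proof. by apply/eqP => -[/eqP]; rewrite oner_eq0. Qed.

HB.instance Definition _ := GRing.Zmodule_isComNzRing.Build B
  galg_mulA galg_mulC galg_mul1 galg_mulDl galg_one_neq0.

Fact galg_scaleAl (a : R) (u v : B) : a *: (u * v) = (a *: u) * v.
Proof.
case: u => [[r x] n]; case: v => [[s y] p]; congr (_, _, _) => /=.
- exact: mulrA.
- by rewrite !scalerDr !scalerA (mulrC a s).
- by rewrite !scalerDr sbZl !scalerA (mulrC a s).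
Qed.
HB.instance Definition _ := GRing.Lmodule_isLalgebra.Build R B galg_scaleAl.
HB.instance Definition _ := GRing.Lalgebra_isComAlgebra.Build R B.

End GradedAlgebra.

(** * Additive maps *)

Lemma additive_fun0 (U V : zmodType) (f : U -> V) : additive_fun f -> f 0 = 0.
Proof. by move=> fD; apply: (addrI (f 0)); rewrite -fD !addr0. Qed.

Lemma additive_funB (U V : zmodType) (f : U -> V) :
  additive_fun f -> {morph f : x y / x - y}.
Proof.
move=> fD x y; apply: (addIr (f y)); rewrite -fD.
by rewrite subrK subrK.
Qed.

Lemma additive_fun_sum (U V : zmodType) (f : U -> V) (I : Type) (r : seq I) F :
  additive_fun f -> f (\sum_(i <- r) F i) = \sum_(i <- r) f (F i).
Proof. by move=> fD; apply: (big_morph f fD); apply: additive_fun0. Qed.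

(** * The tensor square and the kernel of multiplication *)

Section TensorSquare.
Variables (k : fieldType) (R T : comAlgType k) (i1 i2 : R -> T).
Hypothesis hT : is_tensor_square i1 i2.

(** The universal property maps [T] into the subspace [Q] spanned inside [P]; followed by the
    inclusion, this map fixes pure tensors, hence is the identity by uniqueness. *)
Lemma tensor_ind (P : T -> Prop) :
  P 0 -> (forall x y, P x -> P y -> P (x + y)) ->
  (forall a b, P (i1 a * i2 b)) -> forall x, P x.
Proof.
move=> P0 PD Pt; have [[i1D i1Z i1M i11] [i2D i2Z i2M i21] ext] := hT.
(* [P] need not be stable under scaling; requiring it of all multiples of [x] makes a subspace. *)
pose Q x := forall c : k, P (c *: x).
have Qsub : submod_axiom Q.
  split=> [c|a x y Qx Qy c]; first by rewrite scaler0.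
  by rewrite scalerDr scalerA; apply: PD.
have Qt a b : submod_pred Qsub (i1 a * i2 b).
  by apply/asboolP => c; rewrite scalerAl -i1Z.
pose t a b : submod_type Qsub := Submod (Qt a b).
have [f [fD fZ ft]] : exists f : T -> submod_type Qsub,
    [/\ additive_fun f, scalable_fun f & forall x y, f (i1 x * i2 y) = t x y].
  apply: (ext _ t _ _).1 => y; split=> [u v|c u]; apply: val_inj => /=.
  - by rewrite i1D mulrDl.
  - by rewrite i1Z scalerAl.
  - by rewrite i2D mulrDr.
  - by rewrite i2Z scalerAr.
have fid : (fun x => val (f x)) =1 id.
  apply: (ext T (fun x y => i1 x * i2 y) _ _).2 => //.
  - by move=> y; split=> [u v|c u]; rewrite ?i1D ?mulrDl ?i1Z ?scalerAl.
  - by move=> x; split=> [u v|c u]; rewrite ?i2D ?mulrDr ?i2Z ?scalerAr.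
  - by move=> x y; rewrite fD.
  - by move=> c x; rewrite fZ.
  - by move=> x y; rewrite ft.
by move=> x; rewrite -(fid x) -[val _]scale1r; apply: (submodP (f x) 1).
Qed.

Lemma mult_map_ex : exists m : T -> R,
  [/\ additive_fun m, scalable_fun m & forall a b, m (i1 a * i2 b) = a * b].
Proof.
have [_ _ ext] := hT; apply: (ext R (fun x y => x * y) _ _).1 => y.
  by split=> [u v|c u]; rewrite ?mulrDl ?scalerAl.
by split=> [u v|c u]; rewrite ?mulrDr ?scalerAr.
Qed.

Variable m : T -> R.
Hypotheses (mD : additive_fun m) (mZ : scalable_fun m)
  (mt : forall a b, m (i1 a * i2 b) = a * b).
Local Notation I := (I_R i1 i2).

(** Multiplication maps are unique, so the quantifier over all of them in [I_R] reduces to the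
    single map [m]. *)
Lemma I_RP x : I x <-> m x = 0.
Proof.
split=> [Ix|mx0 m' m'D m'Z m't]; first exact: Ix.
have [_ _ ext] := hT; rewrite -mx0; apply: (ext R (fun x y => x * y) _ _).2 => //.
- by move=> y; split=> [u v|c u]; rewrite ?mulrDl ?scalerAl.
- by move=> y; split=> [u v|c u]; rewrite ?mulrDr ?scalerAr.
- by move=> a b; rewrite mt.
Qed.

Lemma mult_mapM x y : m (x * y) = m x * m y.
Proof.
have [[i1D i1Z i1M i11] [i2D i2Z i2M i21] _] := hT.
elim/tensor_ind: x => [|x x' IHx IHx'|a b].
- by rewrite mul0r additive_fun0 // mul0r.
- by rewrite mulrDl !mD IHx IHx' mulrDl.
elim/tensor_ind: y => [|y y' IHy IHy'|c d].
- by rewrite mulr0 additive_fun0 // mulr0.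
- by rewrite mulrDr !mD IHy IHy' mulrDr.
by rewrite mulrACA -i1M -i2M !mt mulrACA.
Qed.

Lemma mult_map_i1 a : m (i1 a) = a.
Proof. by have [_ [_ _ _ i21] _] := hT; rewrite -[i1 a]mulr1 -i21 mt mulr1. Qed.

Lemma I_R0 : I 0.
Proof. by apply/I_RP; rewrite additive_fun0. Qed.

Lemma I_RD x y : I x -> I y -> I (x + y).
Proof. by move=> /I_RP mx /I_RP my; apply/I_RP; rewrite mD mx my addr0. Qed.

Lemma I_RMl c x : I x -> I (c * x).
Proof. by move=> /I_RP mx; apply/I_RP; rewrite mult_mapM mx mulr0. Qed.

Lemma I_RMr c x : I x -> I (x * c).
Proof. by rewrite mulrC; apply: I_RMl. Qed.

Lemma I_R_delta r : I (i2 r - i1 r).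
Proof.
apply/I_RP; have [[_ _ _ i11] _ _] := hT.
by rewrite additive_funB // mult_map_i1 -[i2 r]mul1r -i11 mt mul1r subrr.
Qed.

(** The projection of [T] onto [I] along [i1 R]. It extends maps that are controlled only on [I] to
    the whole of [T], where [tensor_ind] applies. *)
Definition I_proj x := x - i1 (m x).

Lemma I_projP x : I (I_proj x).
Proof. by apply/I_RP; rewrite additive_funB // mult_map_i1 subrr. Qed.

Lemma I_proj_id x : I x -> I_proj x = x.
Proof.
have [[i1D _ _ _] _ _] := hT.
by move=> /I_RP mx; rewrite /I_proj mx additive_fun0 // subr0.
Qed.

Lemma I_projD : additive_fun I_proj.
Proof.
by have [[i1D _ _ _] _ _] := hT => x y; rewrite /I_proj mD i1D opprD addrACA.
Qed.

Lemma I_proj_tensor a b : I_proj (i1 a * i2 b) = i1 a * (i2 b - i1 b).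
Proof. by have [[_ _ i1M _] _ _] := hT; rewrite /I_proj mt i1M mulrBr. Qed.

(** * Linear maps on the modules of differentials *)

Section OmegaHom.
Variables (M : lmodType R) (g : T -> M).
Hypothesis gL : Rlinear_on_I i1 i2 g.

Lemma Rlinear_on_ID x y : I x -> I y -> g (x + y) = g x + g y.
Proof.
have [[_ _ _ i11] _ _] := hT; move=> Ix Iy.
by rewrite -[x]mul1r -i11 gL // scale1r i11 mul1r.
Qed.

Lemma Rlinear_on_I0 : g 0 = 0.
Proof.
by apply: (addrI (g 0)); rewrite -Rlinear_on_ID ?addr0 //; exact: I_R0.
Qed.

Lemma Rlinear_on_IZ r x : I x -> g (i1 r * x) = r *: g x.
Proof. by move=> Ix; rewrite -[_ * x]addr0 gL ?Rlinear_on_I0 ?addr0 //; exact: I_R0. Qed.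

Lemma Rlinear_on_I_sum n (F : 'I_n -> T) : (forall i, I (F i)) ->
  I (\sum_(i < n) F i) /\ g (\sum_(i < n) F i) = \sum_(i < n) g (F i).
Proof.
elim: n F => [|n IHn] F FI.
  by rewrite !big_ord0 Rlinear_on_I0; split=> //; exact: I_R0.
rewrite !big_ord_recl; have [IS gS] := IHn (fun i => F (lift ord0 i)) (fun i => FI _).
by split; [apply: I_RD | rewrite Rlinear_on_ID // gS].
Qed.

(** Since [I] is an ideal, the coefficient of each product can be absorbed into its first factor,
    which exists because there are [q.+1] of them. *)
Lemma Omega_homP q :
  Omega_hom i1 i2 q g <->
  (forall a : 'I_q.+1 -> T, (forall l, I (a l)) -> g (\prod_(l < q.+1) a l) = 0).
Proof.
split=> [[_ g0] a Ia|g0].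
  by apply: g0; exists 1%N, (fun=> 1), (fun=> a); rewrite big_ord1 mul1r.
split=> // x [n [c [a [Ia ->]]]].
have prodE i : c i * \prod_(l < q.+1) a i l =
    \prod_(l < q.+1) (if l == ord0 then c i * a i l else a i l).
  by rewrite !big_ord_recl eqxx mulrA.
have Ica i l : I (if l == ord0 then c i * a i l else a i l).
  by case: ifP => _ //; apply: I_RMl.
rewrite (Rlinear_on_I_sum _).2 => [|i]; first by rewrite big1 // => i _; rewrite prodE g0.
by rewrite prodE big_ord_recl; exact/(I_RMr _ (Ica i ord0)).
Qed.

Lemma Omega_hom1P :
  Omega_hom i1 i2 1 g <-> (forall x y, I x -> I y -> g (x * y) = 0).
Proof.
rewrite Omega_homP; split=> [g0 x y Ix Iy|g0 a Ia].
  have := g0 (fun l => if l == ord0 then x else y).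
  by rewrite !big_ord_recl big_ord0 /= mulr1; apply => l; case: ifP.
by rewrite !big_ord_recl big_ord0 mulr1 g0.
Qed.

Lemma Omega_hom2P :
  Omega_hom i1 i2 2 g <->
  (forall x y z, I x -> I y -> I z -> g (x * (y * z)) = 0).
Proof.
rewrite Omega_homP; split=> [g0 x y z Ix Iy Iz|g0 a Ia].
  have := g0 (fun l => if l == ord0 then x else if l == lift ord0 ord0 then y else z).
  by rewrite !big_ord_recl big_ord0 /= mulr1; apply => l; do 2?case: ifP.
by rewrite !big_ord_recl big_ord0 mulr1 g0.
Qed.
End OmegaHom.

(** If [x] lies in $I^2$ and [y] in $I$, then [x * y] lies in $I^3$, which [h] kills. *)
Lemma Omega_hom1_mul (M : lmodType R) (h : T -> M) y :
  Omega_hom i1 i2 2 h -> I y -> Omega_hom i1 i2 1 (fun x => h (x * y)).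
Proof.
move=> h2 Iy; have hL := h2.1.
have L : Rlinear_on_I i1 i2 (fun x => h (x * y)).
  by move=> r x x' Ix Ix'; rewrite mulrDl -mulrA hL //; exact: I_RMl.
by apply/Omega_hom1P => // x z Ix Iz; rewrite -mulrA (Omega_hom2P hL).1.
Qed.

Lemma Omega_hom12 (M : lmodType R) (g : T -> M) :
  Omega_hom i1 i2 1 g -> Omega_hom i1 i2 2 g.
Proof.
move=> g1; apply/(Omega_hom2P g1.1) => x y z Ix Iy Iz.
by apply: (Omega_hom1P g1.1).1 => //; exact: I_RMl.
Qed.

(** * Linear maps out of degrees 1 and 2 of the symmetric algebra *)

Section Sym.
Variables (S : comAlgType R) (j : T -> S).
Hypothesis hS : is_sym_alg_Omega1 i1 i2 j.

Let j1 : Omega_hom i1 i2 1 j := hS.1.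
Let jL : Rlinear_on_I i1 i2 j := j1.1.

(** The universal property of [S] only yields algebra morphisms. A linear map becomes one with
    values in the graded algebra for the zero pairing, and is read off in degree 1. *)
Lemma sym_alg_linear (M : lmodType R) (g : T -> M) : Omega_hom i1 i2 1 g ->
  exists psi : S -> M, [/\ additive_fun psi, scalable_fun psi &
    forall x, I x -> psi (j x) = g x].
Proof.
move=> g1; have gL := g1.1.
have b0 : sym_bilinear (fun _ _ : M => 0 : M).
  by split=> // a x x' y; rewrite scaler0 addr0.
pose phi x : graded_alg b0 := (0, g x, 0).
have phiL : Rlinear_on_I i1 i2 phi.
  by move=> r x y Ix Iy; congr (_, _, _); rewrite /= ?gL // scaler0 addr0.
have phi1 : Omega_hom i1 i2 1 phi.
  by apply/(Omega_hom1P phiL) => x y Ix Iy; rewrite /phi (Omega_hom1P gL).1.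
have [[psi [[psiD psiZ _ _] psij]] _] := hS.2 _ phi phi1.
exists (fun s => (psi s).1.2); split=> [s t|a s|x Ix].
- by rewrite psiD.
- by rewrite psiZ.
- by rewrite psij.
Qed.

Lemma sym_alg_factor (M : lmodType R) (g : T -> M) x y :
  Omega_hom i1 i2 1 g -> I x -> I y -> j x = j y -> g x = g y.
Proof.
by move=> /sym_alg_linear[psi [_ _ psij]] Ix Iy jxy; rewrite -!psij // jxy.
Qed.

(** The image of [I] under [j]. By [sym_alg_factor] every map on $\Omega^{(1)}$ factors through it,
    so it serves as a concrete model of $\Omega^{(1)}$. *)
Definition in_Omega1 (s : S) := exists2 x, I x & j x = s.

Lemma in_Omega1_submod : submod_axiom in_Omega1.
Proof.
split=> [|r _ _ [x Ix <-] [y Iy <-]].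
  by exists 0; [exact: I_R0 | exact: Rlinear_on_I0].
by exists (i1 r * x + y); [apply: I_RD => //; exact: I_RMl | exact: jL].
Qed.

Local Notation Omega1 := (submod_type in_Omega1_submod).

Lemma Omega1_map_ex : exists emb : T -> Omega1,
  Omega_hom i1 i2 1 emb /\ forall x, I x -> val (emb x) = j x.
Proof.
have /boolp.choice[emb embE] : forall x, exists w : Omega1, val w = j (I_proj x).
  move=> x; apply: submod_ex.
  by exists (I_proj x) => //; exact: I_projP.
have embj x : I x -> val (emb x) = j x by move=> Ix; rewrite embE I_proj_id.
exists emb; split=> //.
have embL : Rlinear_on_I i1 i2 emb.
  move=> r x y Ix Iy; apply: val_inj; have Irx : I (i1 r * x) by exact: I_RMl.
  by rewrite linearP /= !embj ?jL //; exact: I_RD.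
apply/(Omega_hom1P embL) => x y Ix Iy; apply: val_inj.
by rewrite embj ?(Omega_hom1P jL).1 //; exact: I_RMl.
Qed.

(** The pairing [b] descends to $\Omega^{(1)}$ and becomes the product $\Omega^{(1)} \times
    \Omega^{(1)} \to N$ of a graded algebra. The algebra morphism out of [S] induced by [emb] then
    sends [j x * j y] to [b x y] in degree 2. *)
Lemma sym_alg_square (N : lmodType R) (b : T -> T -> N) :
  (forall x y, I x -> I y -> b x y = b y x) ->
  (forall y, I y -> Omega_hom i1 i2 1 (b^~ y)) ->
  exists psi : S -> N, [/\ additive_fun psi, scalable_fun psi &
    forall x y, I x -> I y -> psi (j x * j y) = b x y].
Proof.
move=> bC b1.
have wd x x' y y' : I x -> I x' -> I y -> I y' -> j x = j x' -> j y = j y' ->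
    b x y = b x' y'.
  move=> Ix Ix' Iy Iy' jxx' jyy'.
  rewrite (sym_alg_factor (b1 y Iy) Ix Ix' jxx') !(bC x') //.
  exact: (sym_alg_factor (b1 x' Ix')).
(* Representatives in [I] are chosen arbitrarily; [wd] makes the pairing independent of the
   choice. *)
have /boolp.choice[pre preP] : forall w : Omega1, exists x, I x /\ j x = val w.
  by move=> w; have [x Ix jx] := submodP w; exists x.
have [emb [emb1 embj]] := Omega1_map_ex.
have preI w := (preP w).1; have jpre w := (preP w).2.
have bM : sym_bilinear (fun u v => b (pre u) (pre v)).
  split=> [u v|a u u' v]; first exact: bC.
  have Iau : I (i1 a * pre u) by exact: I_RMl.
  rewrite -(b1 (pre v) (preI v)).1 //; apply: wd => //; first exact: I_RD.
  by rewrite jpre jL // !jpre linearP.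
pose phi x : graded_alg bM := (0, emb x, 0).
have phiL : Rlinear_on_I i1 i2 phi.
  move=> r x y Ix Iy; congr (_, _, _); rewrite /= ?scaler0 ?addr0 //.
  exact: emb1.1.
have phi1 : Omega_hom i1 i2 1 phi.
  by apply/(Omega_hom1P phiL) => x y Ix Iy; rewrite /phi (Omega_hom1P emb1.1).1.
have [[psi [[psiD psiZ psiM _] psij]] _] := hS.2 _ phi phi1.
exists (fun s => (psi s).2); split=> [s t|a s|x y Ix Iy].
- by rewrite psiD.
- by rewrite psiZ.
rewrite psiM !psij //=; rewrite !scaler0 add0r addr0.
by apply: wd => //; rewrite jpre embj.
Qed.

(** * The second-order map defined by a symmetric derivation *)

Section Derivation.
Variable D : S -> S.
Hypothesis hD : symmetric_derivation i1 i2 j D.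

Lemma sym_der_delta r : D r%:A = j (i2 r - i1 r).
Proof. by case: hD. Qed.

Lemma sym_der_algM a b : D (a * b)%:A = a *: D b%:A + b *: D a%:A.
Proof.
have [_ [_ _ DM] _] := hD.
by rewrite -[(a * b)%:A]scalerA -[b%:A]mul1r scalerAl DM mul1r !mulr_algl.
Qed.

Lemma j_proj_tensor a b : j (I_proj (i1 a * i2 b)) = a *: D b%:A.
Proof.
rewrite I_proj_tensor Rlinear_on_IZ ?sym_der_delta //; exact: I_R_delta.
Qed.

Lemma j_projD : additive_fun (fun x => j (I_proj x)).
Proof.
by move=> x y; rewrite I_projD Rlinear_on_ID //; exact: I_projP.
Qed.

(* [x |-> m x + j (I_proj x) e + sq x e^2 / 2] is the truncated Taylor morphism
   [a (x) b |-> a * exp (e D) b] from [T] to [S[e]/(e^3)]; the last identity is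
   its multiplicativity in degree 2. *)
Lemma sym_der_square_ex : exists sq : T -> S,
  [/\ additive_fun sq,
      forall a b, sq (i1 a * i2 b) = a *: D (D b%:A),
      forall r x, sq (i1 r * x) = r *: sq x &
      forall x y, sq (x * y) = m x *: sq y + m y *: sq x
                               + (j (I_proj x) * j (I_proj y)) *+ 2].
Proof.
have [_ [DD DZ DM] _] := hD.
have [[i1D i1Z i1M i11] [i2D i2Z i2M i21] ext] := hT.
have [sq [sqD sqZ sqt]] : exists sq : T -> restrict_scalars S,
    [/\ additive_fun sq, scalable_fun sq &
        forall a b, sq (i1 a * i2 b) = a *: D (D b%:A)].
  apply: (ext (restrict_scalars S) (fun a b => a *: D (D b%:A)) _ _).1.
    move=> b; split=> [a a'|c a]; first by rewrite scalerDl.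
    by rewrite -[c *: a]mulr_algl -scalerA.
  move=> a; split=> [b b'|c b]; first by rewrite scalerDl !DD scalerDr.
  rewrite -[c *: b]mulr_algl -[(_ * b)%:A]scalerA !DZ.
  by rewrite scalerA mulrC -scalerA.
exists sq; split=> // [r x|].
  elim/tensor_ind: x => [|x y IHx IHy|a b].
  - by rewrite mulr0 (additive_fun0 sqD) scaler0.
  - by rewrite mulrDr !sqD IHx IHy scalerDr.
  - by rewrite mulrA -i1M !sqt scalerA.
elim/tensor_ind=> [|x x' IHx IHx' y|a b].
- move=> y; rewrite mul0r (additive_fun0 mD) (additive_fun0 sqD) (additive_fun0 j_projD).
  by rewrite scale0r scaler0 mul0r mul0rn !addr0.
- rewrite mulrDl sqD IHx IHx' mD sqD j_projD scalerDl scalerDr mulrDl mulrnDl.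
  by rewrite addrACA; congr (_ + _); rewrite addrACA.
elim/tensor_ind=> [|y y' IHy IHy'|c d].
- rewrite mulr0 (additive_fun0 mD) (additive_fun0 sqD) (additive_fun0 j_projD).
  by rewrite scale0r scaler0 mulr0 mul0rn !addr0.
- rewrite mulrDr sqD IHy IHy' mD sqD j_projD scalerDl scalerDr mulrDr mulrnDl.
  by rewrite addrACA; congr (_ + _); rewrite addrACA.
rewrite mulrACA -i1M -i2M !sqt !mt !j_proj_tensor.
(* The action of [R] is rewritten as multiplication inside [S], so that [ring] can finish the
   Leibniz computation. *)
have [al [alE alM]] : exists al : R -> S,
    (forall r s, r *: s = al r * s) /\ {morph al : r s / r * s}.
  exists (fun r => r%:A); split=> [r s|r s]; first by rewrite mulr_algl.
  by rewrite mulr_algl scalerA.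
rewrite !alE !mulr1 !alM DM DD !DM; ring.
Qed.

(** * The map [sq] on $\Omega^{(2)}$ and its values in $S^2$ *)

Section Square.
Variable sq : T -> S.
Hypotheses (sqD : additive_fun sq)
  (sqt : forall a b, sq (i1 a * i2 b) = a *: D (D b%:A))
  (sqZ : forall r x, sq (i1 r * x) = r *: sq x)
  (sqM : forall x y, sq (x * y) = m x *: sq y + m y *: sq x
                               + (j (I_proj x) * j (I_proj y)) *+ 2).

(** On [I] the map [m] vanishes, so only the cross term of [sqM] survives. *)
Lemma sym_der_squareM x y : I x -> I y -> sq (x * y) = (j x * j y) *+ 2.
Proof.
move=> Ix Iy; rewrite sqM !I_proj_id //.
by move: Ix Iy => /I_RP-> /I_RP->; rewrite !scale0r !add0r.
Qed.

Lemma sym_der_square_hom (N : lmodType R) (psi : S -> N) :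
  additive_fun psi -> scalable_fun psi -> Omega_hom i1 i2 2 (fun x => psi (sq x)).
Proof.
move=> psiD psiZ.
have L : Rlinear_on_I i1 i2 (fun x => psi (sq x)).
  by move=> r x y _ _; rewrite sqD sqZ psiD psiZ.
apply/(Omega_hom2P L) => x y z Ix Iy Iz; have Iyz : I (y * z) by exact: I_RMl.
rewrite sym_der_squareM // [j (y * z)](Omega_hom1P jL).1 //.
by rewrite mulr0 mul0rn additive_fun0.
Qed.

(* [sq] takes its values in [S^2], by the degree condition on [D]. *)
Lemma sym_der_square_eq (N : lmodType R) (psi1 psi2 : S -> N) :
  additive_fun psi1 -> scalable_fun psi1 ->
  additive_fun psi2 -> scalable_fun psi2 ->
  (forall x y, I x -> I y -> psi1 (j x * j y) = psi2 (j x * j y)) ->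
  forall x, psi1 (sq x) = psi2 (sq x).
Proof.
move=> psi1D psi1Z psi2D psi2Z psiE; elim/tensor_ind=> [|x y IHx IHy|a b].
- by rewrite (additive_fun0 sqD) !additive_fun0.
- by rewrite sqD psi1D psi2D IHx IHy.
rewrite sqt psi1Z psi2Z; congr (_ *: _).
have [Dp _ _] := hD.
(* As [D b] has degree 1, [D (D b)] has degree 2 and is a combination of products of two values of
   [j], where the two maps agree. *)
have S1 : Sdeg i1 i2 j 1 (D b%:A).
  rewrite sym_der_delta; exists 1%N, (fun=> 1), (fun _ _ => i2 b - i1 b).
  by split=> [_ _|]; rewrite ?big_ord1 ?big_ord1 ?scale1r //; exact: I_R_delta.
have [n [c [e [Ie ->]]]] := Dp _ _ S1.
rewrite !additive_fun_sum //; apply: eq_bigr => i _.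
by rewrite psi1Z psi2Z !big_ord_recl big_ord0 mulr1 psiE.
Qed.

(** * Splitting off $\Omega^{(1)}$ and transfer of projectivity *)

Variable half : R.
Hypothesis halfP : forall (N : lmodType R) (v : N), half *: (v *+ 2) = v.

Lemma Omega_hom_sub_square (N : lmodType R) (h : T -> N) (psi : S -> N) :
  Omega_hom i1 i2 2 h -> additive_fun psi -> scalable_fun psi ->
  (forall x y, I x -> I y -> psi (j x * j y) = h (x * y)) ->
  Omega_hom i1 i2 1 (fun x => h x - half *: psi (sq x)).
Proof.
move=> h2 psiD psiZ psij; have [hL _] := h2.
have [sL _] := sym_der_square_hom psiD psiZ.
have L : Rlinear_on_I i1 i2 (fun x => h x - half *: psi (sq x)).
  move=> r x y Ix Iy; rewrite hL // sL // scalerDr scalerBr.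
  by rewrite !scalerA [half * r]mulrC opprD addrACA.
apply/(Omega_hom1P L) => x y Ix Iy.
rewrite sym_der_squareM // mulr2n psiD -mulr2n halfP psij //.
by rewrite subrr.
Qed.

Lemma sym_alg_square_hom (N : lmodType R) (h : T -> N) : Omega_hom i1 i2 2 h ->
  exists psi : S -> N, [/\ additive_fun psi, scalable_fun psi &
    forall x y, I x -> I y -> psi (j x * j y) = h (x * y)].
Proof.
move=> h2; apply: (sym_alg_square (b := fun x y => h (x * y))) => [x y _ _|y Iy].
  by rewrite mulrC.
exact: Omega_hom1_mul.
Qed.

(** A lift of [g] through $\Omega^{(2)}$ need not kill $I^2$; subtracting its $S^2$ part repairs
    this without changing the image under [f]. *)
Lemma Omega_projective21 : Omega_projective i1 i2 2 -> Omega_projective i1 i2 1.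
Proof.
move=> proj2 N L f fD fZ fsurj g g1.
have [h [h2 fh]] := proj2 N L f fD fZ fsurj g (Omega_hom12 g1).
have [psi [psiD psiZ psij]] := sym_alg_square_hom h2.
exists (fun x => h x - half *: psi (sq x)); split.
  exact: Omega_hom_sub_square.
move=> x Ix; rewrite additive_funB // fZ fh //.
(* The correction dies under [f]: on products it equals [g (y * z)], which is zero because [g] kills
   $I^2$. *)
rewrite (@sym_der_square_eq _ (fun s => f (psi s)) (fun=> 0)) ?scaler0 ?subr0 //.
- by move=> s t; rewrite psiD fD.
- by move=> a s; rewrite psiZ fZ.
- by move=> s t; rewrite addr0.
- by move=> a s; rewrite scaler0.
- move=> y z Iy Iz; rewrite psij // fh ?(Omega_hom1P g1.1).1 //; exact: I_RMl.
Qed.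

(** Expanding both factors in the dual basis gives $g(xy) = \sum_{i,l} \phi_i(x) \phi_l(y) g(e_i
    e_l)$. It is enough to choose preimages of the finitely many $g(e_i e_l)$; the resulting pairing
    is symmetric because $e_i e_l = e_l e_i$. *)
Lemma Omega_lift_square (N L : lmodType R) (f : N -> L) (g : T -> L)
    n (e : 'I_n -> T) (phi : 'I_n -> T -> R^o) :
  additive_fun f -> scalable_fun f -> (forall y, exists x, f x = y) ->
  Omega_hom i1 i2 2 g ->
  (forall i, I (e i)) -> (forall i, Omega_hom i1 i2 1 (phi i)) ->
  (forall x, I x -> j x = \sum_i (phi i x : R) *: j (e i)) ->
  exists psi : S -> N, [/\ additive_fun psi, scalable_fun psi &
    forall x y, I x -> I y -> f (psi (j x * j y)) = g (x * y)].
Proof.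
move=> fD fZ /boolp.choice[s sK] g2 Ie phi1 phij.
pose b x y := \sum_i \sum_l ((phi i x : R) * phi l y) *: s (g (e i * e l)).
have bC x y : b x y = b y x.
  rewrite /b exchange_big; apply: eq_bigr => i _; apply: eq_bigr => l _ /=.
  by rewrite mulrC [e l * _]mulrC.
have b1 y : I y -> Omega_hom i1 i2 1 (b^~ y).
  move=> Iy; have bL : Rlinear_on_I i1 i2 (b^~ y).
    move=> r x x' Ix Ix'; rewrite scaler_sumr -big_split; apply: eq_bigr => i _ /=.
    rewrite scaler_sumr -big_split; apply: eq_bigr => l _ /=.
    by rewrite (phi1 i).1 // -[r *: phi i x]/(r * (phi i x : R)) mulrDl scalerDl -mulrA -scalerA.
  apply/(Omega_hom1P bL) => x z Ix Iz; rewrite /b big1 // => i _.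
  by rewrite big1 // => l _; rewrite (Omega_hom1P (phi1 i).1).1 // mul0r scale0r.
(* The dual basis relation holds for [j x] in [S]; it is carried to [g] through the linear map on
   [S] that represents [x |-> g (x * y)]. *)
have gE x y : I x -> I y -> g (x * y) = \sum_i (phi i x : R) *: g (e i * y).
  move=> Ix Iy; have [psi [psiD psiZ psij]] := sym_alg_linear (Omega_hom1_mul g2 Iy).
  rewrite -psij // phij // additive_fun_sum //; apply: eq_bigr => i _.
  by rewrite psiZ psij.
have [psi [psiD psiZ psij]] := sym_alg_square (fun x y _ _ => bC x y) b1.
exists psi; split=> // x y Ix Iy; rewrite psij // gE // /b additive_fun_sum //.
apply: eq_bigr => i _; rewrite additive_fun_sum // mulrC gE // scaler_sumr.
by apply: eq_bigr => l _; rewrite fZ sK scalerA [e l * _]mulrC.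
Qed.

(** By the Leibniz rule, the elements [b] with [D b] in the span of the [j (e i)] form a subalgebra
    containing the generators of [R]. Every element of [I] is a sum of projected pure tensors, and
    [j] sends these to multiples [a *: D b]. *)
Lemma Omega1_generators : affine_algebra R ->
  exists (n : nat) (e : 'I_n -> T), (forall i, I (e i)) /\
    forall x, I x -> exists c : 'I_n -> R, j x = \sum_i c i *: j (e i).
Proof.
move=> [n [r genR]]; pose e i := i2 (r i) - i1 (r i).
exists n, e; split=> [i|x Ix]; first exact: I_R_delta.
pose P (s : S) := exists c : 'I_n -> R, s = \sum_i c i *: j (e i).
have P0 : P 0 by exists (fun=> 0); rewrite big1 // => i _; rewrite scale0r.
have PZ a s : P s -> P (a *: s).
  move=> [c ->]; exists (fun i => a * c i); rewrite scaler_sumr.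
  by apply: eq_bigr => i _; rewrite scalerA.
have PD s t : P s -> P t -> P (s + t).
  move=> [c ->] [d ->]; exists (fun i => c i + d i); rewrite -big_split.
  by apply: eq_bigr => i _; rewrite scalerDl.
have [_ [DD DZ DM] _] := hD.
have PDer b : P (D b%:A).
  elim: (genR b) => {b} [b [i ->]||b c _ Pb _ Pc|b c _ Pb _ Pc|a b _ Pb].
  - exists (fun l => (l == i)%:R); rewrite sym_der_delta (bigD1 i) //= eqxx scale1r.
    by rewrite big1 ?addr0 // => l /negbTE->; rewrite scale0r.
  - suff -> : D 1%:A = 0 by [].
    (* The Leibniz rule for [1 * 1] gives $D(1) = D(1) + D(1)$. *)
    apply: (addrI (D 1%:A)); rewrite addr0 -[in RHS](mulr1 1) sym_der_algM.
    by rewrite !scale1r.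
  - by rewrite scalerDl DD; apply: PD.
  - by rewrite sym_der_algM; apply: PD; apply: PZ.
  - by rewrite -[a *: b]mulr_algl -[(_ * b)%:A]scalerA DZ; apply: PZ.
rewrite -(I_proj_id Ix) -/(P _).
elim/tensor_ind: {Ix}x => [|x y Px Py|a b].
- by rewrite (additive_fun0 j_projD).
- by rewrite j_projD; apply: PD.
- by rewrite j_proj_tensor; apply: PZ.
Qed.

(** Generators give a surjection from a free module of finite rank onto $\Omega^{(1)}$. Projectivity
    lifts the universal map [emb] through it, and the coordinates of the lift are the dual
    functionals. *)
Lemma Omega1_dual_basis : affine_algebra R -> Omega_projective i1 i2 1 ->
  exists (n : nat) (e : 'I_n -> T) (phi : 'I_n -> T -> R^o),
    [/\ forall i, I (e i), forall i, Omega_hom i1 i2 1 (phi i) &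
        forall x, I x -> j x = \sum_i (phi i x : R) *: j (e i)].
Proof.
move=> hR proj1; have [n [e [Ie gen]]] := Omega1_generators hR.
have [emb [emb1 embj]] := Omega1_map_ex.
pose f (v : 'rV[R]_n) := \sum_i v 0 i *: emb (e i).
have valf v : val (f v) = \sum_i v 0 i *: j (e i).
  by rewrite linear_sum; apply: eq_bigr => i _; rewrite linearZ /= embj.
have fD : additive_fun f.
  move=> u v; rewrite /f -big_split; apply: eq_bigr => i _ /=.
  by rewrite mxE scalerDl.
have fZ : scalable_fun f.
  move=> a v; rewrite /f scaler_sumr; apply: eq_bigr => i _.
  by rewrite mxE scalerA.
have fsurj w : exists v, f v = w.
  have [x Ix jx] := submodP w; have [c jc] := gen x Ix.
  exists (\row_i c i); apply: val_inj; rewrite valf -jx jc.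
  by apply: eq_bigr => i _; rewrite mxE.
have [h [h1 fh]] := proj1 _ _ f fD fZ fsurj emb emb1.
exists n, e, (fun i x => h x 0 i); split=> // [i|x Ix].
  have hL : Rlinear_on_I i1 i2 (fun x => h x 0 i : R^o).
    by move=> r x y Ix Iy; rewrite h1.1 // !mxE.
  by apply/(Omega_hom1P hL) => x y Ix Iy; rewrite (Omega_hom1P h1.1).1 // mxE.
by rewrite -embj // -fh // valf.
Qed.

(** The map [g] is the sum of a map on $\Omega^{(1)}$ and a map factoring through $S^2$. The first
    lifts by projectivity, the second by the dual basis, and the lifts are added. *)
Lemma Omega_projective12 : affine_algebra R ->
  Omega_projective i1 i2 1 -> Omega_projective i1 i2 2.
Proof.
move=> hR proj1 N L f fD fZ fsurj g g2.
have [n [e [phi [Ie phi1 phij]]]] := Omega1_dual_basis hR proj1.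
have [psiL [psiLD psiLZ psiLj]] := sym_alg_square_hom g2.
have [psi [psiD psiZ psij]] := Omega_lift_square fD fZ fsurj g2 Ie phi1 phij.
have [h [h1 fh]] := proj1 _ _ f fD fZ fsurj _
  (Omega_hom_sub_square g2 psiLD psiLZ psiLj).
have [hL _] := h1.
have h2 := Omega_hom12 h1; have s2 := sym_der_square_hom psiD psiZ.
exists (fun x => h x + half *: psi (sq x)); split.
  have L2 : Rlinear_on_I i1 i2 (fun x => h x + half *: psi (sq x)).
    move=> r x y Ix Iy; rewrite hL // s2.1 // !scalerDr.
    by rewrite !scalerA [half * r]mulrC addrACA.
  apply/(Omega_hom2P L2) => x y z Ix Iy Iz.
  by rewrite (Omega_hom2P hL).1 // (Omega_hom2P s2.1).1 // scaler0 addr0.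
move=> x Ix; rewrite fD fh // fZ.
(* Both [f psi] and [psiL] send [j y * j z] to [g (y * z)], so they agree on values of [sq] and the
   subtracted term is restored. *)
rewrite (@sym_der_square_eq _ (fun s => f (psi s)) psiL) ?subrK //.
- by move=> s t; rewrite psiD fD.
- by move=> a s; rewrite psiZ fZ.
- by move=> y z Iy Iz; rewrite psij // psiLj.
Qed.

End Square.
End Derivation.
End Sym.
End TensorSquare.

Theorem theorem3p9 (k : closedFieldType) (chark0 : [pchar k] =i pred0)
  (R : comAlgType k) (hR : affine_algebra R)
  (T : comAlgType k) (i1 i2 : R -> T) (hT : is_tensor_square i1 i2)
  (S : comAlgType R) (j : T -> S) (hS : is_sym_alg_Omega1 i1 i2 j)
  (hD : exists D : S -> S, symmetric_derivation i1 i2 j D) :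
  Omega_projective i1 i2 1 <-> Omega_projective i1 i2 2.
Proof.
have [m [mD mZ mt]] := mult_map_ex hT; have [D hD'] := hD.
have [sq [sqD sqt sqZ sqM]] := sym_der_square_ex hT mD mZ mt hS hD'.
have two_neq0 : (2 : k) != 0.
  by apply/negP => two0; have := chark0 2%N; rewrite !inE two0.
(* The inverse of 2 exists in [k] by characteristic zero and is carried into [R] by the structure
   map. *)
pose half : R := (2^-1)%:A.
have halfP (N : lmodType R) (v : N) : half *: (v *+ 2) = v.
  rewrite -scaler_nat scalerA /half -scalerAl mul1r -(scaler_nat 2 (1 : R)).
  by rewrite scalerA mulVf // !scale1r.
split.
  exact: (Omega_projective12 hT mD mZ mt hS hD' sqD sqt sqZ sqM halfP hR).
exact: (Omega_projective21 hT mD mZ mt hS hD' sqD sqt sqZ sqM halfP).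
Qed.
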